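(* For all integers $n,h,b\ge0$, $E_n(h,b)=F_n(h,b)$, where $E_n(h,b)=|\mathcal{B}^{(h,b)}_{n+1}(213)|$ and $F_n(h,b)=|\mathcal{G}(n;h,b)|$.
   Context: For integers $h,b\ge0$, a permutation $\pi\in\mathfrak{S}_{n+1}$ is an $(h,b)$-ballot permutation if the lattice path starting at $(0,h)$ whose $i$th step ($i\in[n]$) is $(1,1)$ if $\pi_i<\pi_{i+1}$ and $(1,-1)$ if $\pi_i>\pi_{i+1}$ ends at $(n,b)$ and never goes below the $x$-axis. $\mathcal{B}^{(h,b)}_{n+1}(213)$ is the set of $(h,b)$-ballot permutations in $\mathfrak{S}_{n+1}$ with no subsequence order-isomorphic to $213$. A Gessel walk is a lattice path confined to $\mathbb{N}^2$ with steps from $\{(0,1),(0,-1),(1,1),(-1,-1)\}$; $\mathcal{G}(n;h,b)$ is the set of $n$-step Gessel walks from $(0,h)$ to $(0,b)$. *)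

(* Defs.v *)
From mathcomp Require Import all_boot all_order all_fingroup all_algebra.
Set Implicit Arguments. Unset Strict Implicit. Unset Printing Implicit Defensive.
Import GRing.Theory Num.Theory.
Local Open Scope ring_scope.

Definition perm_step (n : nat) (pi : {perm 'I_n.+1}) (i : nat) : int :=
  if (pi (inord i) < pi (inord i.+1))%N then 1 else -1.

Definition perm_height (n : nat) (pi : {perm 'I_n.+1}) (h k : nat) : int :=
  (h%:Z + \sum_(0 <= i < k) perm_step pi i).

Definition is_ballot (n h b : nat) (pi : {perm 'I_n.+1}) : bool :=
  [forall k : 'I_n.+1, 0 <= perm_height pi h k] &&
  (perm_height pi h n == b%:Z).

Definition contains213 (m : nat) (pi : {perm 'I_m}) : bool :=
  [exists i : 'I_m, exists j : 'I_m, exists k : 'I_m,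
     [&& (i < j)%N, (j < k)%N, (pi j < pi i)%N & (pi i < pi k)%N]].

Definition E (n h b : nat) : nat :=
  #|[set pi : {perm 'I_n.+1} | is_ballot h b pi && ~~ contains213 pi]|.

Definition gstep (s : 'I_4) : int * int :=
  match val s with
  | 0%N => (0, 1)
  | 1%N => (0, -1)
  | 2%N => (1, 1)
  | _ => (-1, -1)
  end.

Definition gpos (n h : nat) (w : n.-tuple 'I_4) (k : nat) : int * int :=
  (\sum_(i <- take k w) (gstep i).1, h%:Z + \sum_(i <- take k w) (gstep i).2).

Definition is_gessel (n h b : nat) (w : n.-tuple 'I_4) : bool :=
  [forall k : 'I_n.+1, (0 <= (gpos h w k).1) && (0 <= (gpos h w k).2)] &&
  (gpos h w n == (0, b%:Z)).

Definition F (n h b : nat) : nat :=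
  #|[set w : n.-tuple 'I_4 | is_gessel h b w]|.

(* Main.v *)
(** Record a permutation [p] by its code [c_i = #{j < i : p_j < p_i}]; this is a
    bijection onto the sequences with [c_i <= i]. Step [i] is an ascent iff
    [c_i < c_(i+1)], and [p] avoids 213 iff [c_(i+1) <= c_i + 1] for all [i]
    (if 213 occurs, it occurs with its last two entries adjacent). So the
    ballot permutations are walks on pairs (code, height) in which an up step
    sends [c] to [c + 1] and a down step sends [c] to any [a <= c]. Expanded in
    the basis ['C(c, k)], the number of walks from [c] has as coefficients the
    numbers of Gessel walks from abscissa [k] to abscissa [0], because
    ['C(c+1, k) = 'C(c, k) + 'C(c, k-1)] and
    [\sum_(a <= c) 'C(a, k) = 'C(c, k+1) + 'C(c, k)]. At [c = 0] only the
    coefficient [k = 0] survives. *)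

Require Import Defs.
From mathcomp Require Import all_boot all_order all_fingroup all_algebra.
From mathcomp Require Import zify.
Set Implicit Arguments. Unset Strict Implicit. Unset Printing Implicit Defensive.
Import Order.TTheory GRing.Theory Num.Theory.

(** * Sums against binomial coefficients *)

Definition binsum (g : nat -> nat) c := \sum_(k < c.+1) 'C(c, k) * g k.

Lemma binsumD (g1 g2 : nat -> nat) c :
  binsum (fun k => g1 k + g2 k) c = binsum g1 c + binsum g2 c.
Proof. by rewrite /binsum -big_split; apply: eq_bigr => k _; rewrite mulnDr. Qed.

Lemma binsumS (g : nat -> nat) c : binsum g c.+1 = binsum g c + binsum (fun k => g k.+1) c.
Proof.
rewrite /binsum big_ord_recl bin0.
under eq_bigr => i _ do rewrite /= /bump /= add1n binS mulnDl.
rewrite big_split /= addnA; congr (_ + _).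
by rewrite big_ord_recr /= bin_small // addn0 [RHS]big_ord_recl bin0.
Qed.

(** Induction on [c] by Pascal's rule: shifting [g] right and then left gives back [g], so both
    sides grow by [binsum g c.+1]. *)
Lemma sum_binsum (g : nat -> nat) c :
  \sum_(a < c.+1) binsum g a =
  binsum (fun k => g k + if k is k'.+1 then g k' else 0) c.
Proof.
elim: c => [|c IHc]; first by rewrite /binsum !big_ord1 addn0.
rewrite big_ord_recr /= IHc !binsumD (binsumS (fun k => if k is k'.+1 then g k' else 0)).
by rewrite [RHS]addnC; congr (_ + _); apply: addnC.
Qed.

Lemma sum_ord_support N k (f : nat -> nat) :
  k <= N -> (forall a, k <= a -> f a = 0) -> \sum_(a < N) f a = \sum_(a < k) f a.
Proof.
move=> leN f0; rewrite [RHS](big_ord_widen N f) // [RHS]big_mkcond.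
by apply: eq_bigr => a _; case: ltnP => // /f0.
Qed.

Lemma sum_ord_ltn N k : k <= N -> \sum_(a < N) (a < k) = k.
Proof.
move=> leN; rewrite (sum_ord_support (k := k) (f := fun a => (a < k) : nat)) //.
  by rewrite (eq_bigr (fun=> 1)) => [|a _]; rewrite ?sum1_card ?card_ord ?ltn_ord.
by move=> a; rewrite ltnNge => ->.
Qed.

Lemma sum_tupleS (T : finType) m (f : seq T -> nat) :
  \sum_(t : m.+1.-tuple T) f t = \sum_(a : T) \sum_(t : m.-tuple T) f (a :: t).
Proof.
rewrite pair_big /=.
rewrite (reindex (fun p : T * m.-tuple T => cons_tuple p.1 p.2)) //=.
exists (fun t : m.+1.-tuple T => (thead t, behead_tuple t)) => [[a t] _|t _] /=.
  by rewrite theadE; congr pair; apply: val_inj.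
by rewrite [RHS]tuple_eta; apply: val_inj.
Qed.

Lemma sum_tuple0 (T : finType) (f : seq T -> nat) :
  \sum_(t : 0.-tuple T) f t = f [::].
Proof.
rewrite (big_pred1 [tuple]) // => t; apply/esym/eqP; exact: tuple0.
Qed.

(** * Nonnegative integer walks *)

Section Heights.
Local Open Scope ring_scope.

Fixpoint nonneg_walk (y b : int) (s : seq int) : bool :=
  (0 <= y) && (if s is a :: s' then nonneg_walk (y + a) b s' else y == b).

Lemma nonneg_walk_lt0 y b s : y < 0 -> nonneg_walk y b s = false.
Proof. by case: s => [|a s] /=; rewrite ltNge => /negPf->. Qed.

Lemma nonneg_walkE n (s : seq int) y b : size s = n ->
  nonneg_walk y b s =
  [forall k : 'I_n.+1, 0 <= y + \sum_(a <- take k s) a] && (y + \sum_(a <- s) a == b).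
Proof.
elim: s n y => [|a s IHs] [|n] y //=.
  move=> _; rewrite big_nil addr0; congr andb.
  by apply/idP/forallP => [y0 k|/(_ ord0)].
move=> [sz]; rewrite (IHs _ _ sz) big_cons addrA andbA; congr andb.
apply/andP/forallP => [[y0 /forallP ya] [[|k] ltk]|yk] /=.
- by rewrite big_nil addr0.
- by rewrite big_cons addrA (ya (Ordinal (ltk : k < n.+1)%N)).
split; first by have := yk ord0; rewrite /= big_nil addr0.
by apply/forallP=> k; have := yk (lift ord0 k); rewrite /= big_cons addrA.
Qed.

End Heights.

(** * Gessel walks from an arbitrary start *)

Section GesselWalks.
Variable b : nat.

(** The start is any integer point and the final abscissa is 0. A start with a negative coordinate
    gives 0, so the recursion on the first step has no boundary cases. *)
Definition gessel_count m (x y : int) : nat :=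
  \sum_(t : m.-tuple 'I_4)
    (nonneg_walk x 0%R [seq (gstep s).1 | s <- t]
     && nonneg_walk y b%:Z [seq (gstep s).2 | s <- t]).

Lemma F_gessel_count n h : F n h b = gessel_count n 0%R h%:Z.
Proof.
rewrite /F -sum1dep_card big_mkcond /=; apply: eq_bigr => t _.
have szt (f : 'I_4 -> int) : size [seq f s | s <- t] = n by rewrite size_map size_tuple.
rewrite !(nonneg_walkE _ _ (szt _)) /is_gessel /gpos -pair_eqE /= take_oversize ?size_tuple //.
rewrite !big_map add0r andbACA.
set P := [forall k, _]; set Q := [forall k, _] && [forall k, _].
have -> : P = Q.
  apply/forallP/andP => [xy|[/forallP x0 /forallP y0] k].
    by split; apply/forallP=> k; have /andP[] := xy k;
       rewrite /= -!map_take !big_map ?add0r.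
  by have := x0 k; have := y0 k; rewrite -!map_take !big_map add0r => -> ->.
by case: (Q && _).
Qed.

Lemma gessel_count_lt0 m (x y : int) : (x < 0)%R || (y < 0)%R -> gessel_count m x y = 0.
Proof.
by move=> xy; rewrite /gessel_count big1 // => t _; case/orP: xy => xy;
   rewrite (nonneg_walk_lt0 _ _ xy) ?andbF.
Qed.

Lemma gessel_count0 (x y : int) :
  gessel_count 0 x y = (x == 0%R) && ((0 <= y) && (y == b%:Z))%R.
Proof.
rewrite /gessel_count (sum_tuple0 (fun t => (nonneg_walk x 0%R [seq (gstep s).1 | s <- t]
     && nonneg_walk y b%:Z [seq (gstep s).2 | s <- t]) : nat)) /=.
by case: eqP => [->|_]; rewrite ?lexx // andbF.
Qed.

Lemma gessel_countS m (x y : int) : (0 <= x)%R -> (0 <= y)%R ->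
  gessel_count m.+1 x y =
  gessel_count m x (y + 1)%R + gessel_count m x (y - 1)%R
  + gessel_count m (x + 1)%R (y + 1)%R + gessel_count m (x - 1)%R (y - 1)%R.
Proof.
move=> x0 y0; rewrite /gessel_count.
rewrite (sum_tupleS m (fun t => (nonneg_walk x 0%R [seq (gstep s).1 | s <- t]
     && nonneg_walk y b%:Z [seq (gstep s).2 | s <- t]) : nat)).
rewrite !big_ord_recl big_ord0 addn0 !addnA /= x0 y0 /= !addr0.
by [].
Qed.

End GesselWalks.

(** * Walks on pairs (code, height) *)

Section CodeWalks.
Variables (N b : nat).

Definition code_step (c a : nat) : int := if c < a then 1%R else (-1)%R.

Definition slow (c a : nat) : bool := a <= c.+1.

Definition code_walk (c : nat) (y : int) (s : seq nat) : bool :=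
  path slow c s && nonneg_walk y b%:Z (pairmap code_step c s).

(** The alphabet ['I_N] makes the sum finite. When [c + m < N] it cuts off no walk, as each step
    raises the code by at most 1. *)
Definition code_count m (c : nat) (y : int) : nat :=
  \sum_(t : m.-tuple 'I_N) code_walk c y (map val t).

Lemma code_countS m c (y : int) : (0 <= y)%R -> c.+1 < N ->
  code_count m.+1 c y =
  code_count m c.+1 (y + 1)%R + \sum_(a < c.+1) code_count m a (y - 1)%R.
Proof.
move=> y0 ltcN; rewrite /code_count (sum_tupleS m (fun t => code_walk c y (map val t) : nat)).
pose f (a : nat) := \sum_(t : m.-tuple 'I_N) code_walk c y (a :: map val t).
rewrite -[LHS]/(\sum_(a < N) f a) addnC.
have fE a : a <= c.+1 ->
    f a = \sum_(t : m.-tuple 'I_N) code_walk a (y + code_step c a)%R (map val t).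
  by move=> ac; apply: eq_bigr => t _; rewrite /code_walk /= {1}/slow ac y0.
(* Letters above [c.+1] contribute nothing; [c.+1] is the ascent and the smaller letters are the
   descents. *)
rewrite (sum_ord_support ltcN).
  rewrite big_ord_recr /=; congr (_ + _); last by rewrite fE // /code_step ltnSn.
  apply: eq_bigr => a _; rewrite fE; last by rewrite ltnW.
  by rewrite /code_step ltnNge -ltnS ltn_ord.
by move=> a ca; apply: big1 => t _; rewrite /code_walk /= /slow leqNgt ca.
Qed.

Lemma code_count_gessel m c (y : int) : c + m < N ->
  code_count m c y = binsum (fun k => gessel_count b m k%:Z y) c.
Proof.
elim: m c y => [|m IHm] c y ltN.
  rewrite /code_count (sum_tuple0 (fun t : seq 'I_N => code_walk c y (map val t) : nat)).
  rewrite /binsum big_ord_recl /= bin0 mul1n.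
  by rewrite big1 ?addn0 => [|i _]; rewrite gessel_count0 ?muln0.
have [y0|yN] := leP 0%R y; last first.
  rewrite /code_count /binsum big1 => [|t _].
    by rewrite big1 // => k _; rewrite gessel_count_lt0 ?muln0 // yN orbT.
  by rewrite /code_walk (nonneg_walk_lt0 _ _ yN) andbF.
rewrite code_countS //; last by lia.
rewrite IHm; last by lia.
have -> : \sum_(a < c.+1) code_count m a (y - 1)%R =
          \sum_(a < c.+1) binsum (fun k => gessel_count b m k%:Z (y - 1)%R) a.
  by apply: eq_bigr => a _; apply: IHm; have := ltn_ord a; lia.
(* The ascent yields coefficients at abscissae [k] and [k + 1], the descents at [k] and [k - 1]:
   these are the four Gessel steps. *)
rewrite binsumS sum_binsum -!binsumD; apply: eq_bigr => k _; congr (_ * _).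
rewrite gessel_countS //.
have -> : (k%:Z + 1 = k.+1)%R by lia.
rewrite addnACA addnA; congr (_ + _).
(* At [k = 0] the zero from [sum_binsum] matches the forbidden step to abscissa -1. *)
case: (val k) => [|k']; first by rewrite gessel_count_lt0.
by have -> : (k'.+1%:Z - 1 = k')%R by lia.
Qed.

End CodeWalks.

(** * Counting the possible code sequences *)

Fixpoint staircase (k : nat) (s : seq nat) : bool :=
  if s is a :: s' then (a <= k) && staircase k.+1 s' else true.

(** A slow sequence grows no faster than the bound, so code walks from 0 lie in the range of the
    code map. *)
Lemma path_slow_staircase c k s : path slow c s -> c < k -> staircase k s.
Proof.
elim: s c k => //= a s IHs c k /andP[ac pas] ck.
by rewrite (leq_trans ac ck) (IHs a) // (leq_ltn_trans ac).
Qed.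

(** The successive letters have [k + 1], ..., [k + m] choices; the factorial on the left avoids a
    division. *)
Lemma sum_staircase N m k : k + m <= N ->
  k`! * \sum_(t : m.-tuple 'I_N) staircase k (map val t) = (k + m)`!.
Proof.
elim: m k => [|m IHm] k leN.
  by rewrite (sum_tuple0 (fun t : seq 'I_N => staircase k (map val t) : nat)) muln1 addn0.
rewrite (sum_tupleS m (fun t : seq 'I_N => staircase k (map val t) : nat)) /=.
set X := \sum_(t : m.-tuple 'I_N) staircase k.+1 (map val t).
have -> : \sum_(a < N) \sum_(t : m.-tuple 'I_N) ((a <= k) && staircase k.+1 (map val t)) =
          \sum_(a < N) (a < k.+1) * X.
  apply: eq_bigr => a _; rewrite big_distrr /=; apply: eq_bigr => t _.
  by rewrite ltnS; case: (a <= k); case: (staircase _ _).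
rewrite -big_distrl /= sum_ord_ltn; last by lia.
by rewrite mulnA [_ * k.+1]mulnC -factS IHm ?addSnnS // -addSnnS.
Qed.

(** * Codes of sequences *)

Lemma count_ltn_between (s : seq nat) x y : x < y -> x \notin s ->
  count (fun z => z < y) s = count (fun z => z < x) s + count (fun z => x < z < y) s.
Proof.
move=> xy; elim: s => //= z s IHs; rewrite inE negb_or => /andP[xz /IHs->].
by move: xz; case: (ltngtP z x) => // zx _; lia.
Qed.

Section Codes.
Variable p : nat -> nat.

Definition code i := count (fun z => z < p i) (map p (iota 0 i)).

Lemma code_le i : code i <= i.
Proof. by rewrite -{2}(size_iota 0 i) -(size_map p) count_size. Qed.

Lemma codeS i :
  code i.+1 = count (fun z => z < p i.+1) (map p (iota 0 i)) + (p i < p i.+1).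
Proof. by rewrite /code -[X in iota _ X]addn1 iotaD map_cat count_cat /= addn0. Qed.

(** An ascent adds [p i] itself to the entries already counted; at a descent everything below
    [p i.+1] is below [p i]. *)
Lemma code_ascent i : p i != p i.+1 -> (code i < code i.+1) = (p i < p i.+1).
Proof.
rewrite codeS; case: (ltngtP (p i) (p i.+1)) => // lt_p _.
  by rewrite /= addn1 ltnS; apply: sub_count => z /=; move/ltn_trans; apply.
rewrite addn0 ltnNge; apply/negbF.
by apply: sub_count => z /=; move/ltn_trans; apply.
Qed.

(** At an ascent, [code i.+1 - code i - 1] counts the earlier entries strictly between [p i] and
    [p i.+1], each the 2 of a 213 whose 1 and 3 are adjacent. *)
Lemma code_slow i : p i \notin map p (iota 0 i) ->
  slow (code i) (code i.+1) = ~~ has (fun z => p i < z < p i.+1) (map p (iota 0 i)).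
Proof.
move=> pi_new; rewrite codeS /slow; case: (ltnP (p i) (p i.+1)) => lt_p.
  by rewrite (count_ltn_between lt_p pi_new) has_count /code; lia.
rewrite addn0 leqW.
  by symmetry; apply/hasPn => z _; lia.
by apply: sub_count => z /= /leq_trans; apply.
Qed.

Lemma path_code i m : path slow (code i) (map code (iota i.+1 m)) =
  all (fun j => slow (code j) (code j.+1)) (iota i m).
Proof. by elim: m i => //= m IHm i; rewrite IHm. Qed.

Lemma pairmap_code i m : (forall j, i <= j < i + m -> p j != p j.+1) ->
  pairmap code_step (code i) (map code (iota i.+1 m)) =
  [seq (if p j < p j.+1 then 1%R else (-1)%R : int) | j <- iota i m].
Proof.
elim: m i => //= m IHm i pj; congr cons.
  by rewrite /code_step code_ascent //; apply: pj; lia.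
by apply: IHm => j ij; apply: pj; lia.
Qed.

(** Decoding: [code m] fixes the place of [p m] among the earlier entries. If [p j] is below [p m],
    it is counted by [code m] but not by its own rank. *)
Lemma ltn_code j m : j < m -> p j != p m ->
  (p j < p m) = (count (fun z => z < p j) (map p (iota 0 m)) < code m).
Proof.
move=> jm; case: (ltngtP (p j) (p m)) => // lt_p _; last first.
  symmetry; apply/negbTE; rewrite -leqNgt.
  by apply: sub_count => z /=; move/ltn_trans; apply.
symmetry; rewrite /code.
have jIn : p j \in map p (iota 0 m) by apply: map_f; rewrite mem_iota.
move/perm_to_rem/seq.permP: jIn => jIn; rewrite !jIn /= ltnn lt_p add0n add1n ltnS.
by apply: sub_count => z /=; move/ltn_trans; apply.
Qed.

(** A discrete intermediate value argument, used to make the last two entries of a 213 adjacent. *)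
Lemma crossing v j d : p j < v -> v < p (j + d) ->
  (forall m, j <= m <= j + d -> p m != v) ->
  exists m, [&& j <= m, m < j + d, p m < v & v < p m.+1].
Proof.
move=> pj; elim: d => [|d IHd]; first by rewrite addn0; lia.
rewrite addnS => pd pv; case: (ltngtP (p (j + d)) v) => pjd.
- by exists (j + d); rewrite leq_addr ltnSn pjd.
- have [||m mP] := IHd => //; first by move=> m jm; apply: pv; lia.
  by exists m; move: mP; lia.
- by have := pv (j + d); rewrite pjd eqxx leq_addr leqnSn => /(_ isT).
Qed.

End Codes.

(** Induction on prefixes: the ranks of the old entries agree by hypothesis, and [ltn_code] then
    places the new entry. *)
Lemma code_inj_ltn N (p q : nat -> nat) :
  {in gtn N &, injective p} -> {in gtn N &, injective q} ->
  (forall i, i < N -> code p i = code q i) ->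
  forall i j, i < N -> j < N -> (p i < p j) = (q i < q j).
Proof.
move=> p_inj q_inj eq_code.
suff iso m : m <= N -> forall i j, i < m -> j < m -> (p i < p j) = (q i < q j).
  exact: iso.
elim: m => // m IHm mN.
have new i : i < m -> (p i < p m) = (q i < q m).
  move=> im; have iN : i < N := ltn_trans im mN.
  have neq (r : nat -> nat) : {in gtn N &, injective r} -> r i != r m.
    by move=> r_inj; apply: contraTneq im => /r_inj->; rewrite ?ltnn.
  rewrite !ltn_code ?neq // eq_code // !count_map; congr (_ < _).
  by apply: eq_in_count => j; rewrite mem_iota /= => jm; apply: IHm => //; apply: ltnW.
have neq (r : nat -> nat) i : {in gtn N &, injective r} -> i < m -> r i != r m.
  by move=> r_inj im; apply: contraTneq (im) => /r_inj->; rewrite ?ltnn // inE (ltn_trans im).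
move=> i j; rewrite !ltnS leq_eqVlt => /predU1P[->|im]; rewrite leq_eqVlt => /predU1P[->|jm].
- by rewrite !ltnn.
- by have := new j jm; have := neq p j p_inj jm; have := neq q j q_inj jm; lia.
- exact: new.
- by apply: IHm => //; apply: ltnW.
Qed.

(** * Codes of permutations *)

Section PermutationCodes.
Variable n : nat.
Implicit Type pi : {perm 'I_n.+1}.

(** [inord] sends indices above [n] to 0, so injectivity holds only on indices up to [n]. *)
Definition perm_nat pi (i : nat) : nat := pi (inord i).

Lemma perm_nat_inj pi : {in gtn n.+1 &, injective (perm_nat pi)}.
Proof.
move=> i j; rewrite !inE => iN jN /val_inj/perm_inj/(congr1 val).
by rewrite /= !inordK.
Qed.

Lemma perm_nat_neqS pi i : i < n -> perm_nat pi i != perm_nat pi i.+1.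
Proof.
by move=> ltin; apply/eqP => /perm_nat_inj; rewrite !inE; lia.
Qed.

Lemma contains213E pi : ~~ contains213 pi =
  all (fun i => slow (code (perm_nat pi) i) (code (perm_nat pi) i.+1)) (iota 0 n).
Proof.
set p := perm_nat pi.
have new i : i < n.+1 -> p i \notin map p (iota 0 i).
  move=> iN; apply/mapP => -[j]; rewrite mem_iota => ji /perm_nat_inj; rewrite !inE; lia.
apply/idP/allP => [no213 i|sl].
  rewrite mem_iota add0n => /= ltin; rewrite code_slow ?new ?ltnS 1?ltnW //.
  apply: contra no213 => /hasP[_ /mapP[j ji ->] pj].
  move: ji; rewrite mem_iota add0n /= => ji.
  apply/existsP; exists (inord j); apply/existsP; exists (inord i).
  by apply/existsP; exists (inord i.+1); rewrite !inordK; move: pj; rewrite /p /perm_nat; lia.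
apply/negP => /existsP[i /existsP[j /existsP[k /and4P[ij jk pij pik]]]].
have pE (x : 'I_n.+1) : pi x = p x :> nat by rewrite /p /perm_nat inord_val.
move: pij pik; rewrite !pE => pij pik.
have jk' : k = j + (k - j) :> nat by rewrite subnKC // ltnW.
have kN := ltn_ord k.
(* Between [j] and [k] the values cross [p i], which gives an adjacent pair around it. *)
have [||m /and4P[jm mk pm pm1]] := @crossing p (p i) j (k - j) pij; first by rewrite -jk'.
  by move=> m jm; apply/eqP => /perm_nat_inj; rewrite !inE; lia.
have mn : m < n by lia.
have := sl m; rewrite mem_iota add0n => /(_ mn); rewrite code_slow ?new ?ltnS 1?ltnW //.
have pim : p i \in map p (iota 0 m) by rewrite map_f // mem_iota; lia.
by move/hasPn/(_ _ pim); rewrite pm pm1.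
Qed.

Lemma is_ballotE pi h b : is_ballot h b pi =
  nonneg_walk h%:Z b%:Z [seq perm_step pi i | i <- iota 0 n].
Proof.
rewrite (@nonneg_walkE n) ?size_map ?size_iota // /is_ballot /perm_height.
rewrite big_map /index_iota subn0; congr andb.
apply: eq_forallb => k; rewrite -map_take big_map take_iota subn0.
by rewrite (minn_idPl _) // -ltnS.
Qed.

(** Index 0 is omitted: its code is always 0 and becomes the start of the walk. *)
Definition code_tuple pi : n.-tuple 'I_n.+1 :=
  [tuple inord (code (perm_nat pi) i.+1) | i < n].

Lemma val_code_tuple pi :
  map val (code_tuple pi) = map (code (perm_nat pi)) (iota 1 n).
Proof.
rewrite /= -map_comp (iotaDl 1 0) -map_comp -val_enum_ord -map_comp.
apply: eq_map => i /=; rewrite add1n inordK //.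
by rewrite (leq_ltn_trans (code_le _ _)) // ltnS.
Qed.

Lemma code_tuple_inj : injective code_tuple.
Proof.
move=> pi si eq_t.
have eq_code i : i < n.+1 -> code (perm_nat pi) i = code (perm_nat si) i.
  case: i => // i ltin; have := congr1 (fun t => nth 0 (map val (tval t)) i) eq_t.
  by rewrite !val_code_tuple !(nth_map 0) ?size_iota // !nth_iota.
have iso := code_inj_ltn (@perm_nat_inj pi) (@perm_nat_inj si) eq_code.
(* A value of a permutation is the number of smaller values, so the relative order determines the
   permutation. *)
have rankE (s : {perm 'I_n.+1}) i : s i = \sum_j (s j < s i) :> nat.
  rewrite -[LHS](sum_ord_ltn (ltnW (ltn_ord (s i)))).
  by rewrite (reindex_inj (@perm_inj _ s)).
apply/permP => i; apply: val_inj; rewrite /= (rankE pi) (rankE si).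
apply: eq_bigr => j _.
by have := iso j i; rewrite /perm_nat !inord_val => ->.
Qed.

Lemma code_tuple_onto (t : n.-tuple 'I_n.+1) :
  staircase 1 (map val t) -> exists pi, t = code_tuple pi.
Proof.
move=> st_t; suff: t \in code_tuple @: setT by case/imsetP => pi _; exists pi.
(* Surjectivity by counting: the image lies in the staircase set, and both have (n+1)! elements. *)
have: code_tuple @: setT == [set t : n.-tuple 'I_n.+1 | staircase 1 (map val t)].
  rewrite eqEcard card_imset; last exact: code_tuple_inj.
  apply/andP; split.
    apply/subsetP => _ /imsetP[pi _ ->]; rewrite inE val_code_tuple.
    elim: n 0 => //= m IHm i; rewrite IHm andbT; exact: code_le.
  rewrite cardsT card_Sn -sum1dep_card big_mkcond /= -(@sum_staircase n.+1 n 1) //.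
  by rewrite mul1n; apply: eq_leq; apply: eq_bigr => s _; case: staircase.
by move/eqP->; rewrite inE.
Qed.

Lemma E_code_count h b : E n h b = code_count n.+1 b n 0 h%:Z.
Proof.
rewrite /E -(card_imset _ code_tuple_inj) /code_count.
have ballot_code pi : is_ballot h b pi && ~~ contains213 pi =
    code_walk b 0 h%:Z (map val (code_tuple pi)).
  rewrite val_code_tuple /code_walk -[0]/(code (perm_nat pi) 0) path_code contains213E.
  rewrite pairmap_code ?is_ballotE 1?andbC // => j /andP[_ jn].
  exact: perm_nat_neqS.
rewrite -sum1_card big_mkcond; apply: eq_bigr => t _.
suff -> : (t \in [set code_tuple pi | pi in [set pi | is_ballot h b pi && ~~ contains213 pi]])
   = code_walk b 0 h%:Z (map val t) by case: code_walk.
apply/imsetP/idP => [[pi]|wt]; first by rewrite inE ballot_code => wpi ->.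
(* Conversely, a code walk from 0 satisfies the staircase bound, hence is the code of a
   permutation. *)
have /andP[/path_slow_staircase st _] := wt.
have [pi def_t] := code_tuple_onto (st 1 isT).
by exists pi; rewrite // inE ballot_code -def_t.
Qed.

End PermutationCodes.

Theorem theorem4p2 (n h b : nat) : E n h b = F n h b.
Proof.
rewrite E_code_count F_gessel_count code_count_gessel //.
by rewrite /binsum big_ord1 mul1n.
Qed.
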